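(* Let $d\ge 1$, $H\in(0,1)$, and let $X=(X_t)_{t\in[0,T]}$ be an $\mathbb{R}^d$-valued process satisfying Assumption 1 (items (i) and (ii)) with this $H$ and some constants $c_0>0$, $\theta\ge 0$, $c_1\ge 0$, $\iota\ge 0$. Suppose that $$0\leq \alpha<d\ \text{ if } Hd<1,\qquad\text{respectively}\qquad \max\Big(0,d-\frac{1}{H}\Big)<\alpha<d\ \text{ if } Hd\geq 1.$$ Then: (i) For any $t\in(0,T)$ there is a (deterministic) constant $c_4(t)>0$ such that $$\liminf_{r\to 0}\ \sup_{s\in(t-r,t+r)}\frac{\|X_t-X_s\|}{r^H(\log\log r^{-1})^{-H(\frac{\theta}{d-\alpha}+1)}}\geq c_4(t)\qquad\mathbb{P}\text{-a.s.}$$ (ii) There is a (deterministic) constant $c_5>0$ such that $$\liminf_{r\to 0}\ \inf_{t\in(0,T)}\ \sup_{s\in(t-r,t+r)}\frac{\|X_t-X_s\|}{r^H(\log r^{-1})^{-H(\frac{\theta}{d-\alpha}+1)}}\geq c_5\qquad\mathbb{P}\text{-a.s.}$$ In particular, $X$ is almost surely nowhere differentiable.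
   Context: $T>0$ is fixed. $X=(X_t)_{t\in[0,T]}$ is a jointly measurable $\mathbb{R}^d$-valued process on a probability space $(\Omega,\mathcal{F},\mathbb{P})$. $\|\cdot\|$ is the Euclidean norm. ''$\mathbb{P}$-a.s.'' means on a set containing an event of probability one. Times $s\in(t-r,t+r)$ are understood to range over $(t-r,t+r)\cap[0,T]$. Assumption 1. (i) There exist $c_0>0$ and $\theta\geq 0$ such that for any $n\in\mathbb{N}$, any $\xi_j=(\xi_j^1,\ldots,\xi_j^d)\in(\mathbb{R}\setminus\{0\})^d$, $j=1,\ldots,n$, any partition $0=t_0<t_1<\ldots<t_n<T$, and any $k_{j,\ell}\in\{0,4\}$, $$\Big|\mathbb{E}\Big[\exp\Big(i\sum_{j=1}^n\langle\xi_j,X_{t_j}-X_{t_{j-1}}\rangle\Big)\Big]\Big|\leq c_0^n n^{H\theta n}\prod_{j=1}^n\prod_{\ell=1}^d\frac{1}{|\xi_j^\ell|^{k_{j,\ell}}(t_j-t_{j-1})^{Hk_{j,\ell}}}.$$ (ii) There exist $c_1\geq 0$ and $\iota\geq 0$ such that for any $p\geq 1$ and all $0\leq s<t\leq T$, $\mathbb{E}\|X_t-X_s\|^p\leq c_1^p p^{\iota p}|t-s|^{Hp}$. *)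

(* Defs.v *)
From HB Require Import structures.
From mathcomp Require Import all_boot all_order all_algebra.
From mathcomp Require Import all_classical all_reals all_analysis.
From mathcomp Require Import complex.
Set Implicit Arguments.
Unset Strict Implicit.
Unset Printing Implicit Defensive.
Import Order.TTheory GRing.Theory Num.Theory.
Import numFieldNormedType.Exports.
Local Open Scope classical_set_scope.
Local Open Scope ring_scope.

Definition dotp (R : realType) (d : nat) (u v : 'rV[R]_d) : R :=
  \sum_(l < d) u ord0 l * v ord0 l.

(* The library norm on ['rV[R]_d] is the sup norm, hence this definition. *)
Definition enorm (R : realType) (d : nat) (u : 'rV[R]_d) : R :=
  Num.sqrt (dotp u u).

Section Process.
Context (dO : measure_display) (Omega : measurableType dO) (R : realType).
Context (P : probability Omega R) (d : nat).

(* A process is a map on all of [R * Omega]; only its values at times in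
   [[0, T]] are constrained and used. Measurability into R^d is measurability
   of every coordinate. *)
Definition jointly_measurable (T : R) (X : R -> Omega -> 'rV[R]_d) : Prop :=
  forall l : 'I_d,
    measurable_fun (`[0, T]%classic `*` [set: Omega])
      (fun p : R * Omega => X p.1 p.2 ord0 l).

Definition expi (x : R) : R[i] := Complex (cos x) (sin x).

(* Meant for bounded measurable [Z], for which both expectations are finite. *)
Definition complex_expectation (Z : Omega -> R[i]) : R[i] :=
  Complex (fine ('E_P[fun w => complex.Re (Z w)])%E) (fine ('E_P[fun w => complex.Im (Z w)])%E).

(* [xi j] and [k j] for [j : 'I_n] are the paper's xi_{j+1} and k_{j+1}. The
   case [n = 0] reads [1 <= 1], so it does not matter whether 0 is allowed. *)
Definition assumption1_i (T H c0 theta : R) (X : R -> Omega -> 'rV[R]_d) :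
    Prop :=
  forall (n : nat) (xi : 'I_n -> 'rV[R]_d) (t : nat -> R)
         (k : 'I_n -> 'I_d -> nat),
    (forall j l, xi j ord0 l != 0) ->
    t 0%N = 0 -> (forall j : 'I_n, t j < t j.+1) -> t n < T ->
    (forall j l, k j l = 0%N \/ k j l = 4%N) ->
    ComplexField.Normc.normc (complex_expectation (fun w =>
        expi (\sum_(j < n) dotp (xi j) (X (t j.+1) w - X (t j) w))))
      <= c0 ^+ n * n%:R `^ (H * theta * n%:R) *
         \prod_(j < n) \prod_(l < d)
           (1 / (`|xi j ord0 l| ^+ k j l *
                 (t j.+1 - t j) `^ (H * (k j l)%:R))).

Definition assumption1_ii (T H c1 iota : R) (X : R -> Omega -> 'rV[R]_d) :
    Prop :=
  forall p s t : R, 1 <= p -> 0 <= s -> s < t -> t <= T ->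
    ('E_P[fun w => (enorm (X t w - X s w) `^ p)%R] <=
      (c1 `^ p * p `^ (iota * p) * `|t - s| `^ (H * p))%:E)%E.

End Process.

(* [sup_{s in (t - r, t + r) /\ [0, T]} ||f t - f s|| / g] *)
Definition sup_ratio (R : realType) (d : nat) (T : R) (f : R -> 'rV[R]_d)
    (g t r : R) : \bar R :=
  ereal_sup [set (enorm (f t - f s) / g)%:E |
             s in `]t - r, t + r[%classic `&` `[0, T]%classic].

(* Differentiability of a path at [t] relative to [[0, T]]: the usual one for
   [t] in the open interval, one-sided at the endpoints. *)
Definition differentiable_on_at (R : realType) (d : nat) (T : R)
    (f : R -> 'rV[R]_d) (t : R) : Prop :=
  exists v : 'rV[R]_d,
    (s - t)^-1 *: (f s - f t) @[s --> within `[0, T]%classic t^'] --> v.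

Definition nowhere_differentiable (R : realType) (d : nat) (T : R)
    (f : R -> 'rV[R]_d) : Prop :=
  forall t, t \in `[0, T] -> ~ differentiable_on_at T f t.

(* Main.v *)
Require Import Defs.
From mathcomp Require Import all_boot all_order all_algebra.
From mathcomp Require Import all_classical all_reals all_analysis.
From mathcomp Require Import measurable_realfun complex ring lra.
Import Order.TTheory GRing.Theory Num.Theory.
Import numFieldNormedType.Exports.
Local Open Scope classical_set_scope.
Local Open Scope ring_scope.

(* No local time is needed. The squared modulus of (1/N) sum_(k < N) e^(ikx) is
   a nonnegative trigonometric polynomial, at least 1/4 for |x| <= 1/(2N). Along
   a grid of n steps of length D, expand the product of these polynomials in the
   coordinates of the increments divided by D^H: Assumption 1 (i), with exponent
   4 at the nonzero frequencies, bounds the probability that all coordinates of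
   all increments are at most D^H/(2N) by
   c0^(n+1) (n+1)^(H theta (n+1)) (20/N)^(nd). With N of order n^(H theta/d)
   this is exponentially small in n, so outside an exponentially unlikely event
   X oscillates by order delta^H n^(-H(theta/d + 1)) on an interval of length
   delta = n D. Borel-Cantelli along delta = e^(-m) gives (i) with n of order
   log m and one interval, (ii) with n of order m and about e^m intervals; since
   alpha >= 0, the exponent of the logarithm is even better than required.
   Oscillation bounds hold at every t without path continuity, and r is
   negligible against the modulus in (ii), hence nowhere differentiability. *)

(** * Trigonometric polynomials: positivity, product expansion, weights of the frequencies *)

Lemma cos_lipschitz {R : realType} (x y : R) : `|cos x - cos y| <= `|x - y|.
Proof.
wlog xy : x y / y <= x.
  move=> W; have [/W//|/ltW/W] := leP y x.
  by rewrite distrC [leRHS]distrC.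
have dcos z : z \in `]y, x[ -> is_derive z 1 cos (- sin z).
  by move=> _; exact: is_derive_cos.
have [c _ ->] := MVT_segment xy dcos (continuous_subspaceT (@continuous_cos R)).
by rewrite normrM normrN ler_piMl// sin_max.
Qed.

Lemma expiD {R : realType} (x y : R) : expi (x + y) = expi x * expi y.
Proof.
apply/eqP; rewrite eq_complex /= cosD sinD eqxx /= (addrC (sin x * _)) //.
Qed.

Lemma expi_sum {R : realType} (I : finType) (F : I -> R) :
  expi (\sum_i F i) = \prod_i expi (F i).
Proof.
apply: (big_morph (@expi R)); first exact: expiD.
by rewrite /expi cos0 sin0.
Qed.

Lemma sum_complex {R : realType} (I : finType) (F G : I -> R) :
  \sum_i Complex (F i) (G i) = Complex (\sum_i F i) (\sum_i G i).
Proof.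
elim/big_rec3: _ => // i x y z _ ->; exact/eqP.
Qed.

Section Dirichlet.
Context {R : realType} {N : nat}.

(** Indexing by pairs, with repetition, makes the sum of cosines the squared modulus of a geometric
    sum, [N] times the Fejer kernel, with no multiplicities to count. *)
Definition freq (p : 'I_N * 'I_N) : R := p.1%:R - p.2%:R.

Lemma sum_sin_freq (x : R) : \sum_p sin (freq p * x) = 0.
Proof.
pose s (p : 'I_N * 'I_N) := (p.2, p.1).
have sK : cancel s s by case.
have : \sum_p sin (freq p * x) = - \sum_p sin (freq p * x).
  rewrite {1}(reindex_inj (can_inj sK)) /= -sumrN; apply: eq_bigr => p _.
  by rewrite /freq /= -sinN -mulNr opprB.
move/eqP; rewrite -subr_eq0 opprK -mulr2n mulrn_eq0 /=; by move/eqP.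
Qed.

Lemma sum_cos_freq (x : R) :
  \sum_p cos (freq p * x) =
  (\sum_(k < N) cos (k%:R * x)) ^+ 2 + (\sum_(k < N) sin (k%:R * x)) ^+ 2.
Proof.
rewrite !expr2 !big_distrlr /= !pair_bigA /= -big_split /=.
apply: eq_bigr => p _.
by rewrite /freq /= mulrBl cosB.
Qed.

Lemma sum_cos_freq_ge0 (x : R) : 0 <= \sum_p cos (freq p * x).
Proof. by rewrite sum_cos_freq addr_ge0 ?sqr_ge0. Qed.

(** Each [k%:R * x] has modulus at most 1/2, so its cosine is at least 1/2 by the Lipschitz bound;
    the square of the sine sum is dropped. *)
Lemma sum_cos_freq_ge (x : R) : `|x| <= (2 * N%:R)^-1 ->
  N%:R ^+ 2 / 4 <= \sum_p cos (freq p * x).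
Proof.
move=> xN; rewrite sum_cos_freq.
apply: (@le_trans _ _ ((\sum_(k < N) cos (k%:R * x)) ^+ 2)); last first.
  by rewrite lerDl sqr_ge0.
have cos_ge (k : 'I_N) :  2^-1 <= cos (k%:R * x).
  have := cos_lipschitz (k%:R * x) 0.
  rewrite cos0 subr0 normrM normr_nat => h.
  have N0 : 0 < N%:R :> R by rewrite ltr0n (leq_ltn_trans _ (ltn_ord k)).
  have kN : k%:R * `|x| <= 2^-1.
    apply: le_trans (ler_wpM2l _ xN) _ => //.
    rewrite invfM mulrCA ger_pMr// ler_pdivrMr// mul1r ler_nat.
    exact/ltnW/ltn_ord.
  have /andP[] : - (k%:R * `|x|) <= cos (k%:R * x) - 1 <= k%:R * `|x|.
    by rewrite -ler_norml.
  lra.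
have le_sum : N%:R / 2 <= \sum_(k < N) cos (k%:R * x).
  have -> : N%:R / 2 = \sum_(k < N) 2^-1 :> R.
    by rewrite sumr_const card_ord mulr_natl.
  by apply: ler_sum => k _; exact: cos_ge.
have -> : N%:R ^+ 2 / 4 = (N%:R / 2) ^+ 2 :> R by field.
by rewrite lerXn2r ?nnegrE ?divr_ge0// (le_trans _ le_sum)// divr_ge0.
Qed.

(* Odd parts cancel by symmetry of the frequencies, so only cosines survive. *)
Lemma prod_sum_cos_freq (I : finType) (y : I -> R) :
  \prod_i (\sum_p cos (freq p * y i)) =
  \sum_(f : {ffun I -> 'I_N * 'I_N}) cos (\sum_i freq (f i) * y i).
Proof.
have prodC (F : I -> R) : \prod_i Complex (F i) 0 = Complex (\prod_i F i) 0.
  elim/big_rec2: _ => // i x z _ ->.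
  by apply/eqP; rewrite eq_complex /= !mulr0 mul0r subr0 addr0 !eqxx.
have : \prod_i \sum_p expi (freq p * y i) =
  \sum_(f : {ffun I -> 'I_N * 'I_N}) expi (\sum_i freq (f i) * y i).
  rewrite bigA_distr_bigA; apply: eq_bigr => f _; exact/esym/expi_sum.
rewrite sum_complex.
under eq_bigr => i _ do rewrite sum_complex sum_sin_freq.
by rewrite prodC => -[].
Qed.

End Dirichlet.

Lemma sum_inv_pow4_le2 {R : realType} (n : nat) :
  \sum_(k < n) (k.+1%:R ^+ 4)^-1 <= 2 :> R.
Proof.
case: n => [|n]; first by rewrite big_ord0.
(* Strengthened so that the induction telescopes: the next term is at most 1/(a(a+1)) = 1/a -
   1/(a+1). *)
suff : \sum_(k < n.+1) (k.+1%:R ^+ 4)^-1 <= 2 - (n.+1%:R)^-1 :> R.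
  by move/le_trans; apply; rewrite gerBl invr_ge0.
elim: n => [|n IH]; first by rewrite big_ord1 expr1n invr1; lra.
rewrite big_ord_recr /=; apply: (le_trans (lerD IH (lexx _))).
have a0 : 1 <= n.+1%:R :> R by rewrite ler1n.
rewrite -(natr1 n.+1); set a : R := n.+1%:R in a0 *.
have -> : 2 - (a + 1)^-1 = 2 - a^-1 + (a * (a + 1))^-1.
  by field; apply/andP; split; lra.
rewrite lerD2l lef_pV2 ?posrE ?exprn_gt0//; [|lra|nra].
have -> : (a + 1) ^+ 4 = (a + 1) ^+ 3 * (a + 1) by ring.
rewrite ler_pM2r; last lra.
rewrite 2!exprS expr1; nra.
Qed.

(* Assumption 1 (i) is used with [k = 0] at frequency 0 and [k = 4] elsewhere. *)
Definition freq_weight {R : realType} {N : nat} (p : 'I_N * 'I_N) : R :=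
  if freq p == 0 :> R then 1 else (`|freq p| ^+ 4)^-1.

(** Passing from [N] to [N.+1] adds a diagonal entry of weight 1 and a row and a column of weight at
    most 2 each, whence 5. *)
Lemma sum_freq_weight {R : realType} (N : nat) :
  \sum_(p : 'I_N * 'I_N) freq_weight p <= 5 * N%:R :> R.
Proof.
pose w (i j : nat) : R :=
  if i%:R - j%:R == 0 :> R then 1 else (`|i%:R - j%:R : R| ^+ 4)^-1.
have -> : \sum_(p : 'I_N * 'I_N) freq_weight p = \sum_(i < N) \sum_(j < N) w i j.
  by rewrite pair_bigA.
have wC i j : w i j = w j i.
  by rewrite /w distrC -(opprB j%:R) oppr_eq0.
have wn n : w n n = 1 by rewrite /w subrr eqxx.
have half n : \sum_(j < n) w n j <= 2.
  apply: le_trans (sum_inv_pow4_le2 n).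
  rewrite (reindex_inj rev_ord_inj) /=; apply: ler_sum => j _.
  rewrite /w -natrB ?leq_subr// subKn//.
  by rewrite pnatr_eq0 /= normr_nat.
elim: N => [|N IH]; first by rewrite big_ord0 mulr0.
rewrite big_ord_recr /= big_ord_recr /= wn -natr1.
under eq_bigr => i _ do rewrite big_ord_recr /= wC.
rewrite big_split /=.
have := half N; lra.
Qed.

(** * Measurability and integrability of the increments *)

Section Measurability.
Context {dO : measure_display} {Omega : measurableType dO} {R : realType}
  {P : probability Omega R} {d : nat} {T : R} {X : R -> Omega -> 'rV[R]_d}.
Hypothesis X_meas : jointly_measurable T X.

Lemma measurable_coord (t : R) (l : 'I_d) : 0 <= t <= T ->
  measurable_fun [set: Omega] (fun w => X t w ord0 l).
Proof.
move=> t0T.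
apply: (measurable_comp _ _ (X_meas l) (pair1_measurable t)).
- exact: measurableX.
- by move=> _ [w _ <-]; split => //=; rewrite in_itv.
Qed.

Lemma measurable_coordB (s t : R) (l : 'I_d) : 0 <= s <= T -> 0 <= t <= T ->
  measurable_fun [set: Omega] (fun w => X t w ord0 l - X s w ord0 l).
Proof. by move=> sT tT; apply: measurable_funB; exact: measurable_coord. Qed.

Lemma measurable_dotpB (xi : 'rV[R]_d) (s t : R) :
  0 <= s <= T -> 0 <= t <= T ->
  measurable_fun [set: Omega] (fun w => dotp xi (X t w - X s w)).
Proof.
move=> sT tT; rewrite /dotp; apply: measurable_sum => l.
apply: measurable_funM; first exact: measurable_cst.
under eq_fun do rewrite !mxE; exact: measurable_coordB.
Qed.

Lemma coord_le_enorm (u : 'rV[R]_d) (l : 'I_d) : `|u ord0 l| <= enorm u.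
Proof.
rewrite -sqrtr_sqr /enorm ler_wsqrtr// /dotp (bigD1 l)//= -expr2 lerDl.
by apply: sumr_ge0 => i _; rewrite -expr2 sqr_ge0.
Qed.

Lemma measurable_enormB (s t : R) : 0 <= s <= T -> 0 <= t <= T ->
  measurable_fun [set: Omega] (fun w => enorm (X t w - X s w)).
Proof.
move=> sT tT; apply: measurableT_comp.
  by apply: continuous_measurable_fun; exact: sqrt_continuous.
apply: measurable_sum => l; under eq_fun do rewrite !mxE.
by apply: measurable_funM; exact: measurable_coordB.
Qed.

Lemma integrable_coordB (H c1 iota s t : R) (l : 'I_d) :
  assumption1_ii P T H c1 iota X -> 0 <= s -> s < t -> t <= T ->
  P.-integrable [set: Omega] (EFin \o (fun w => X t w ord0 l - X s w ord0 l)).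
Proof.
move=> A1ii s0 st tT.
have sT : 0 <= s <= T by rewrite s0 (le_trans (ltW st) tT).
have t0T : 0 <= t <= T by rewrite (le_trans s0 (ltW st)).
have mB := measurable_coordB s t l sT t0T.
apply/integrableP; split; first exact/measurable_EFinP.
have /= := A1ii 1 s t (lexx 1) s0 st tT; rewrite expectation.unlock.
move=> /le_lt_trans/(_ (ltry _)); apply: le_lt_trans.
apply: ge0_le_integral => //.
- apply/measurable_EFinP; exact: measurableT_comp.
- apply/measurable_EFinP; under eq_fun do rewrite powRr1 ?sqrtr_ge0//.
  exact: measurable_enormB.
- move=> w _ /=; rewrite powRr1 ?sqrtr_ge0// lee_fin.
  by have := coord_le_enorm (X t w - X s w) l; rewrite !mxE.
Qed.

End Measurability.

Section Integrals.
Context {dO : measure_display} {Omega : measurableType dO} {R : realType}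
  {P : probability Omega R}.

Lemma integrable_cos (f : Omega -> R) : measurable_fun [set: Omega] f ->
  P.-integrable [set: Omega] (EFin \o (fun w => cos (f w))).
Proof.
move=> mf; apply: measurable_bounded_integrable => //.
- by rewrite (le_lt_trans (probability_le1 _ _))// ltry.
- apply: measurableT_comp => //.
  by apply: continuous_measurable_fun; exact: continuous_cos.
- exists 1; split; first by rewrite num_real.
  by move=> M /ltW M1 w _; exact: le_trans (cos_max _) M1.
Qed.

(** Integrability is carried through the induction because additivity of the integral requires it of
    the tail. *)
Lemma Rintegral_sum (I : Type) (s : seq I) (f : I -> Omega -> R) :
  (forall i, P.-integrable [set: Omega] (EFin \o f i)) ->
  P.-integrable [set: Omega] (EFin \o (fun w => \sum_(i <- s) f i w)) /\
  \int[P]_w (\sum_(i <- s) f i w) = \sum_(i <- s) \int[P]_w f i w.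
Proof.
move=> fi; elim: s => [|i s [IHi IHe]].
  have -> : (fun w => \sum_(i <- [::]) f i w) = cst 0.
    by apply/funext => w; rewrite big_nil.
  rewrite big_nil Rintegral_cst// mul0r; split => //; exact: integrable0.
have -> : (fun w => \sum_(i <- i :: s) f i w) =
          (fun w => f i w + \sum_(i <- s) f i w).
  by apply/funext => w; rewrite big_cons.
by rewrite big_cons RintegralD// IHe; split => //; exact: (integrableD measurableT (fi i) IHi).
Qed.

End Integrals.

(** * Fourier bound for the probability that all increments are small *)

Section SmallBall.
Context {dO : measure_display} {Omega : measurableType dO} {R : realType}
  {P : probability Omega R} {d : nat} {T H c0 theta c1 iota : R}
  {X : R -> Omega -> 'rV[R]_d}.
Hypothesis c0_gt0 : 0 < c0.
Hypothesis X_meas : jointly_measurable T X.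
Hypothesis A1i : assumption1_i P T H c0 theta X.
Hypothesis A1ii : assumption1_ii P T H c1 iota X.

(* Zero components of [xi] are allowed where [k = 0]: perturb them by [e] and
   let [e] tend to 0, using that increments have a finite first moment. *)
Lemma Rintegral_cos_le (n : nat) (xi : 'I_n -> 'rV[R]_d) (t : nat -> R)
    (k : 'I_n -> 'I_d -> nat) :
  t 0%N = 0 -> (forall j : 'I_n, t j < t j.+1) -> t n < T ->
  (forall j l, k j l = 0%N \/ k j l = 4%N /\ xi j ord0 l != 0) ->
  \int[P]_w cos (\sum_(j < n) dotp (xi j) (X (t j.+1) w - X (t j) w))
    <= c0 ^+ n * n%:R `^ (H * theta * n%:R) *
       \prod_(j < n) \prod_(l < d)
         (1 / (`|xi j ord0 l| ^+ k j l *
               (t j.+1 - t j) `^ (H * (k j l)%:R))).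
Proof.
move=> t0 tS tnT kxi.
have mono i j : (i <= j <= n)%N -> t i <= t j.
  elim: j => [|j IH]; first by case: i.
  move=> /andP[]; rewrite leq_eqVlt => /predU1P[->//|ij jn].
  apply: le_trans (IH _) (ltW (tS (Ordinal jn))).
  by rewrite -ltnS ij ltnW.
have tT i : (i <= n)%N -> 0 <= t i <= T.
  by move=> ?; rewrite -t0 !(le_trans _ (ltW tnT)) ?mono ?leqnn ?andbT.
have tjT (j : 'I_n) : 0 <= t j <= T by apply: tT; exact: ltnW.
have tSjT (j : 'I_n) : 0 <= t j.+1 <= T by exact: tT.
pose xie e j : 'rV[R]_d := \row_l (if xi j ord0 l == 0 then e else xi j ord0 l).
pose U y w := \sum_(j < n) dotp (y j) (X (t j.+1) w - X (t j) w).
have mU y : measurable_fun [set: Omega] (U y).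
  by apply: measurable_sum => j; exact: measurable_dotpB.
pose D (p : 'I_n * 'I_d) w := X (t p.1.+1) w ord0 p.2 - X (t p.1) w ord0 p.2.
have iD p : P.-integrable [set: Omega] (EFin \o (fun w => `|D p w|)).
  have [/andP[t_ge0 _] /andP[_ tS_leT]] := (tjT p.1, tSjT p.1).
  exact: integrable_norm
    (integrable_coordB X_meas _ _ _ _ _ p.2 A1ii t_ge0 (tS p.1) tS_leT).
set B := (X in _ <= X).
have le_e e : 0 < e ->
    \int[P]_w cos (U xi w) <= B + e * \sum_p \int[P]_w `|D p w|.
  move=> e0.
  have [iG eG] := Rintegral_sum _ (index_enum ('I_n * 'I_d)%type) (fun p w => `|D p w|) iD.
  apply: (@le_trans _ _ (\int[P]_w (cos (U (xie e) w) + e * \sum_p `|D p w|))).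
    apply: le_Rintegral => //.
    - exact: integrable_cos.
    - exact: (integrableD measurableT (integrable_cos _ (mU _))
                (integrableZl measurableT e iG)).
    (* The cosine is 1-Lipschitz and only the zero components of [xi] move, each by [e]. *)
    - move=> w _; rewrite -lerBlDl; apply: le_trans (ler_norm _) _.
      apply: le_trans (cos_lipschitz _ _) _.
      rewrite /U -sumrB; apply: le_trans (ler_norm_sum _ _ _) _.
      rewrite mulr_sumr -(pair_bigA _ (fun j l => e * `|D (j, l) w|)) /=.
      apply: ler_sum => j _; rewrite /dotp -sumrB.
      apply: le_trans (ler_norm_sum _ _ _) _; apply: ler_sum => l _.
      rewrite -mulrBl normrM !mxE; case: eqP => [->|_].
        by rewrite sub0r normrN (gtr0_norm e0).
      by rewrite subrr normr0 mul0r mulr_ge0// ltW.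
  rewrite RintegralD//; [|exact: integrable_cos|exact: (integrableZl measurableT e iG)].
  rewrite RintegralZl// eG lerD2r.
  have := A1i n (xie e) t k _ t0 tS tnT _.
  rewrite /complex_expectation /= expectation.unlock /= => A.
  (* The perturbed components carry [k = 0], so the right-hand side is unchanged. *)
  have -> : B = c0 ^+ n * n%:R `^ (H * theta * n%:R) *
       \prod_(j < n) \prod_(l < d)
         (1 / (`|xie e j ord0 l| ^+ k j l *
               (t j.+1 - t j) `^ (H * (k j l)%:R))).
    congr (_ * _); apply: eq_bigr => j _; apply: eq_bigr => l _.
    rewrite /xie mxE; case: eqP => [z|//].
    by case: (kxi j l) => [->|[_]]; rewrite ?expr0// z eqxx.
  apply: le_trans (A _ _).
  (* The integral of the cosine is the real part of the expectation, hence at most its modulus. *)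
  - apply: le_trans (ler_norm _) _; rewrite -sqrtr_sqr ler_wsqrtr//.
    by rewrite lerDl sqr_ge0.
  - by move=> j l; rewrite mxE; have [_|] := eqVneq (xi j ord0 l) 0 => //; rewrite (gt_eqF e0).
  - by move=> j l; case: (kxi j l) => [|[]]; [left|right].
set M := \sum_p _ in le_e.
have M0 : 0 <= M by apply: sumr_ge0 => p _; exact: Rintegral_ge0.
apply/ler_addgt0Pr => e e0.
have M1 : 0 < M + 1 by lra.
apply: (le_trans (le_e (e / (M + 1)) _)); first exact: divr_gt0.
rewrite lerD2l mulrAC ler_pdivrMr// ler_pM2l//; lra.
Qed.


Definition small_increments (n : nat) (a D rho : R) : set Omega :=
  [set w | forall (j : 'I_n) (l : 'I_d),
    `|X (a + j.+1%:R * D) w ord0 l - X (a + j%:R * D) w ord0 l| <= rho].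

Lemma grid_in_horizon (n : nat) (a D : R) : 0 <= a -> 0 <= D -> a + n%:R * D <= T ->
  forall i, (i <= n)%N -> 0 <= a + i%:R * D <= T.
Proof.
move=> a0 D0 aT i iN; rewrite addr_ge0 ?mulr_ge0//=.
by apply: le_trans aT; rewrite lerD2l ler_wpM2r// ler_nat.
Qed.

Lemma measurable_small_increments (n : nat) (a D rho : R) :
  0 <= a -> 0 <= D -> a + n%:R * D <= T ->
  measurable (small_increments n a D rho).
Proof.
move=> a0 D0 aT; have grid := grid_in_horizon _ _ _ a0 D0 aT.
have -> : small_increments n a D rho = \bigcap_(p in [set: 'I_n * 'I_d])
    (fun w => `|X (a + p.1.+1%:R * D) w ord0 p.2 - X (a + p.1%:R * D) w ord0 p.2|)
      @^-1` `]-oo, rho].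
  apply/seteqP; split => [w wA [j l] _|w wA j l] /=; first by rewrite in_itv /= wA.
  by have := wA (j, l) Logic.I; rewrite /= in_itv.
apply: fin_bigcap_measurable => // p _.
rewrite -[X in measurable X]setTI.
apply: (measurableT_comp (@normr_measurable R setT)) => //.
by apply: (measurable_coordB X_meas); apply: grid => //; exact: ltnW.
Qed.

(** Markov's inequality for the product of the trigonometric polynomials: it is nonnegative, at
    least (N^2/4)^(nd) on the event, and has mean at most (5N)^(nd) times the constant from
    [assumption1_i]. *)
Lemma small_increments_le (n N : nat) (a D : R) :
  0 < a -> 0 < D -> a + n%:R * D < T -> (0 < N)%N ->
  (P (small_increments n a D (D `^ H / (2 * N%:R))) <=
   (c0 ^+ n.+1 * n.+1%:R `^ (H * theta * n.+1%:R) *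
     (20 / N%:R) ^+ (n * d))%:E)%E.
Proof.
move=> a0 D0 aT N0.
set A := small_increments _ _ _ _.
have mA : measurable A by exact: measurable_small_increments (ltW a0) (ltW D0) (ltW aT).
have grid := grid_in_horizon _ _ _ (ltW a0) (ltW D0) (ltW aT).
pose h := (D `^ H)^-1.
have DH0 : 0 < D `^ H by exact: powR_gt0.
have h0 : 0 < h by rewrite invr_gt0.
pose y (p : 'I_n * 'I_d) w :=
  h * (X (a + p.1.+1%:R * D) w ord0 p.2 - X (a + p.1%:R * D) w ord0 p.2).
have my p : measurable_fun [set: Omega] (y p).
  apply: measurable_funM; first exact: measurable_cst.
  by apply: (measurable_coordB X_meas); apply: grid => //; exact: ltnW.
pose U (f : {ffun 'I_n * 'I_d -> 'I_N * 'I_N}) w := \sum_p freq (f p) * y p w.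
have mU f : measurable_fun [set: Omega] (U f).
  by apply: measurable_sum => p; apply: measurable_funM; first exact: measurable_cst.
have [iS eS] := Rintegral_sum (P := P) _ (index_enum {ffun 'I_n * 'I_d -> 'I_N * 'I_N})
  (fun f w => cos (U f w)) (fun f => integrable_cos _ (mU f)).
have N0R : 0 < N%:R :> R by rewrite ltr0n.
pose C := c0 ^+ n.+1 * n.+1%:R `^ (H * theta * n.+1%:R).
have le_w f : \int[P]_w cos (U f w) <= C * \prod_p freq_weight (f p).
  (* The partition must start at 0, so the interval from 0 to [a] is prepended with frequency 0; its
     factor is 1, but there are now [n.+1] increments. *)
  pose t i := if i is i'.+1 then a + i'%:R * D else 0.
  pose xi (j : 'I_n.+1) : 'rV[R]_d := \row_l
    (if unlift ord0 j is Some j' then freq (f (j', l)) * h else 0).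
  pose k (j : 'I_n.+1) (l : 'I_d) := if xi j ord0 l == 0 then 0%N else 4%N.
  have := @Rintegral_cos_le n.+1 xi t k erefl _ aT _.
  have -> : \int[P]_w cos (\sum_(j < n.+1) dotp (xi j) (X (t j.+1) w - X (t j) w))
     = \int[P]_w cos (U f w).
    apply: eq_Rintegral => w _; congr cos.
    rewrite big_ord_recl {1}/dotp big1 ?add0r; last first.
      by move=> l _; rewrite !mxE unlift_none mul0r.
    rewrite pair_bigA; apply: eq_bigr => -[j l] _ /=.
    by rewrite !mxE liftK /y /= -mulrA.
  rewrite -/C => le_C; apply: le_trans (le_C _ _) _.
  - case=> -[|j] jn /=; first by rewrite mul0r addr0.
    by rewrite ltrD2l ltr_pM2r// ltr_nat.
  - by move=> j l; rewrite /k; case: eqP; [left|right].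
  rewrite big_ord_recl [X in _ * (X * _)]big1 ?mul1r; last first.
    by move=> l _; rewrite /k mxE unlift_none eqxx mulr0 powRr0 expr0 mulr1 divr1.
  rewrite le_eqVlt; apply/orP; left; apply/eqP.
  rewrite pair_bigA; congr (_ * _); apply: eq_bigr => -[j l] _ /=.
  rewrite /freq_weight /k mxE liftK mulf_eq0 (gt_eqF h0) orbF.
  case: eqP => _; first by rewrite mulr0 powRr0 expr0 mulr1 divr1.
  rewrite /t /= /bump /= add1n.
  have -> : a + j.+1%:R * D - (a + j%:R * D) = D by rewrite -natr1; ring.
  (* The fourth power of [h] in the frequency cancels that of D^H, so the time step disappears from
     the bound. *)
  rewrite powRrM powR_mulrn ?powR_ge0// normrM (gtr0_norm h0) -exprMn /h.
  by rewrite mulfVK ?gt_eqF// div1r.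
have prob_le : (N%:R ^+ 2 / 4) ^+ (n * d) * fine (P A) <= C * (5 * N%:R) ^+ (n * d).
  apply: (@le_trans _ _ (\int[P]_w \sum_f cos (U f w))).
    have -> : fine (P A) = \int[P]_w \1_A w.
      by rewrite /Rintegral integral_indic// setIT.
    have iA : P.-integrable [set: Omega] (EFin \o \1_A).
      exact: integrable_indic.
    rewrite -RintegralZl//.
    apply: le_Rintegral => //; first exact: (integrableZl measurableT _ iA).
    move=> w _ /=; rewrite -prod_sum_cos_freq indicE; case: (asboolP (A w)) => Aw.
      rewrite mem_set// mulr1.
      have -> : (n * d)%N = #|{: 'I_n * 'I_d}| by rewrite card_prod !card_ord.
      rewrite -prodr_const; apply: ler_prod => -[j l] _; apply/andP; split.
        by rewrite divr_ge0.
      apply: sum_cos_freq_ge; rewrite /y /= normrM (gtr0_norm h0) mulrC.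
      by rewrite ler_pdivrMr// [leRHS]mulrC; exact: Aw.
    rewrite memNset// mulr0; apply: prodr_ge0 => p _; exact: sum_cos_freq_ge0.
  rewrite eS; apply: (@le_trans _ _
    (\sum_(f : {ffun 'I_n * 'I_d -> 'I_N * 'I_N}) C * \prod_p freq_weight (f p))).
    by apply: ler_sum => f _; exact: le_w.
  (* The sum over all choices of frequencies factorizes into [n * d] equal sums of weights, each at
     most 5N. *)
  rewrite -mulr_sumr -(bigA_distr_bigA (fun _ p => freq_weight p)).
  rewrite big_const card_prod !card_ord iter_mulr_1.
  have C0 : 0 <= C by rewrite mulr_ge0 ?exprn_ge0 ?powR_ge0// ltW.
  rewrite ler_wpM2l// lerXn2r ?nnegrE ?mulr_ge0 ?sum_freq_weight//.
  by apply: sumr_ge0 => p _; rewrite /freq_weight; case: ifP.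
have PA : P A \is a fin_num by exact: fin_num_measure.
rewrite -(fineK PA) lee_fin -/C.
have -> : 20 / N%:R = 5 * N%:R / (N%:R ^+ 2 / 4) :> R.
  by field; rewrite gt_eqF.
rewrite [X in _ * X]expr_div_n mulrA ler_pdivlMr ?exprn_gt0 ?divr_gt0 ?exprn_gt0//.
by rewrite mulrC.
Qed.

End SmallBall.

(** * Exponential small-ball bound, by choice of the number of frequencies *)

Section SmallBallExp.
Context {dO : measure_display} {Omega : measurableType dO} {R : realType}
  {P : probability Omega R} {d : nat} {T H c0 theta c1 iota : R}
  {X : R -> Omega -> 'rV[R]_d}.
Hypothesis d_ge1 : (1 <= d)%N.
Hypothesis H_gt0 : 0 < H.
Hypothesis theta_ge0 : 0 <= theta.
Hypothesis c0_gt0 : 0 < c0.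
Hypothesis X_meas : jointly_measurable T X.
Hypothesis A1i : assumption1_i P T H c0 theta X.
Hypothesis A1ii : assumption1_ii P T H c1 iota X.

(** With [N] of order n^(H theta/d), the factor (20/N)^(nd) absorbs the growth n^(H theta n), and a
    large constant leaves geometric decay. The rate 3 pays later for a union over about e^m windows
    and for summability in m. *)
Lemma small_increments_expR :
  exists2 kappa : R, 0 < kappa & exists2 C : R, 0 < C &
  forall (n : nat) (a D : R),
  (0 < n)%N -> 0 < a -> 0 < D -> a + n%:R * D < T ->
  (P (small_increments (X := X) n a D
       (kappa * D `^ H * n%:R `^ (- (H * theta / d%:R)))) <=
   (C * expR (- 3 * n%:R))%:E)%E.
Proof.
set g := H * theta; have g0 : 0 <= g by rewrite mulr_ge0// ltW.
have d0 : 0 < d%:R :> R by rewrite ltr0n.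
pose b := 2 `^ g : R; have b0 : 0 < b by exact: powR_gt0.
(* Chosen so that c0 b^2 / M <= e^(-3); the summand 1 gives M >= 1, hence M <= M^d. *)
pose M := 1 + c0 * b ^+ 2 * expR 3.
have e30 : 0 < expR 3 :> R by exact: expR_gt0.
have cb0 : 0 < c0 * b ^+ 2 by rewrite mulr_gt0// exprn_gt0.
have M1 : 1 <= M by rewrite lerDl ltW// mulr_gt0.
have M0 : 0 < M by lra.
exists (80 * M)^-1; first by rewrite invr_gt0 mulr_gt0.
exists (c0 * b); first exact: mulr_gt0.
move=> n a D n0 a0 D0 aT.
have n1 : 1 <= n%:R :> R by rewrite ler1n.
have n0R : 0 < n%:R :> R by lra.
pose x := n%:R `^ g : R; have x0 : 0 < x by exact: powR_gt0.
pose z := n%:R `^ (g / d%:R) : R; have z0 : 0 < z by exact: powR_gt0.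
have z1 : 1 <= z by rewrite -(powRr0 n%:R) ler_powR// divr_ge0// ltW.
have zd : z ^+ d = x by rewrite -powR_mulrn ?ltW// /z -powRrM mulfVK ?gt_eqF.
(* [N] lies between 20Mz and 40Mz: the lower bound gives 20/N <= 1/(Mz), the upper one makes the
   radius with constant 1/(80M) at most D^H/(2N). *)
pose N := (Num.truncn (20 * M * z)).+1.
have N_gt : 20 * M * z < N%:R by exact: truncnS_gt.
have Mz : 1 <= M * z by nra.
have Mz0 : 0 < 20 * M * z by nra.
have N0R : 0 < N%:R :> R by lra.
have N_le : N%:R <= 40 * M * z.
  have := truncn_le (20 * M * z); rewrite (ltW Mz0) => tr.
  rewrite /N -natr1; lra.
have PA := small_increments_le c0_gt0 X_meas A1i A1ii n N _ _ a0 D0 aT (ltn0Sn _).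
have sub : small_increments (X := X) n a D ((80 * M)^-1 * D `^ H * n%:R `^ (- (g / d%:R)))
    `<=` small_increments (X := X) n a D (D `^ H / (2 * N%:R)).
  move=> w wA j l; apply: le_trans (wA j l) _.
  rewrite powRN -/z mulrAC -invfM mulrC ler_wpM2l ?powR_ge0//.
  rewrite lef_pV2 ?posrE//; nra.
apply: (le_trans (le_measure _ _ _ sub)); rewrite ?inE.
- by apply: (measurable_small_increments X_meas); exact: ltW.
- by apply: (measurable_small_increments X_meas); exact: ltW.
apply: le_trans PA _; rewrite lee_fin.
(* Since n+1 <= 2n, each base costs a factor [b]; the surplus [x] is at most b^n because n <= 2^n.
   Exactly the n factors [x] that [frac_le] cancels remain. *)
have pow_le : n.+1%:R `^ (g * n.+1%:R) <= b ^+ (2 * n).+1 * x ^+ n.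
  rewrite powRrM powR_mulrn ?powR_ge0//.
  have Sn_le : n.+1%:R `^ g <= b * x.
    rewrite /b /x -powRM// (ge0_ler_powR g0) ?nnegrE ?mulr_ge0//.
    by rewrite -natr1; lra.
  apply: (@le_trans _ _ ((b * x) ^+ n.+1)).
    by apply: lerXn2r => //; rewrite nnegrE ?powR_ge0// mulr_ge0// ltW.
  have x_le : x <= b ^+ n.
    rewrite /b -powR_mulrn ?powR_ge0// -powRrM mulrC powRrM (ge0_ler_powR g0) ?nnegrE ?powR_ge0//.
    by rewrite powR_mulrn// -natrX ler_nat ltnW// ltn_expl.
  rewrite exprMn [x ^+ n.+1]exprS mul2n -addnn.
  have -> : b ^+ (n + n).+1 * x ^+ n = b ^+ n.+1 * (b ^+ n * x ^+ n).
    by rewrite -addSn exprD mulrA.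
  by rewrite ler_pM2l ?exprn_gt0// ler_pM2r ?exprn_gt0.
have frac_ge0 : 0 <= 20 / N%:R :> R by rewrite divr_ge0.
have frac_le : (20 / N%:R) ^+ (n * d) <= ((M * x)^-1) ^+ n.
  have Mz_inv : 20 / N%:R <= (M * z)^-1.
    rewrite ler_pdivrMr// mulrC ler_pdivlMr; nra.
  have Mx_inv : (M * z)^-1 ^+ d <= (M * x)^-1.
    rewrite exprVn lef_pV2 ?posrE ?exprn_gt0 ?mulr_gt0// exprMn zd ler_pM2r//.
    by rewrite -{1}(expr1 M) ler_weXn2l.
  have Mx_ge0 : 0 <= (M * x)^-1 by rewrite invr_ge0 mulr_ge0// ltW.
  have Mz_ge0 : 0 <= (M * z)^-1 by apply: le_trans Mz_inv.
  rewrite mulnC exprM; apply: lerXn2r; rewrite ?nnegrE ?exprn_ge0//.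
  apply: le_trans Mx_inv; exact: lerXn2r.
apply: (@le_trans _ _ (c0 ^+ n.+1 * (b ^+ (2 * n).+1 * x ^+ n) * ((M * x)^-1) ^+ n)).
  apply: ler_pM => //.
  - by rewrite mulr_ge0 ?powR_ge0// exprn_ge0// ltW.
  - by rewrite ler_pM2l ?exprn_gt0.
have -> : c0 ^+ n.+1 * (b ^+ (2 * n).+1 * x ^+ n) * ((M * x)^-1) ^+ n =
    c0 * b * (c0 * b ^+ 2 / M) ^+ n.
  rewrite (exprS c0) (exprS b) exprM invfM !exprMn !exprVn.
  by field; rewrite !gt_eqF ?exprn_gt0.
rewrite ler_pM2l ?mulr_gt0// [X in expR X]mulrC expRM_natl.
apply: lerXn2r; rewrite ?nnegrE ?expR_ge0//.
  by rewrite divr_ge0// ltW.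
rewrite expRN ler_pdivrMr// [leRHS]mulrC ler_pdivlMr// /M; lra.
Qed.

End SmallBallExp.

(** * Almost sure oscillation along discrete scales *)

Lemma Borel_Cantelli_telescoping {d : measure_display} {T : measurableType d}
    {R : realType} (mu : {measure set T -> \bar R}) (F : nat -> set T) (C : R) :
  (forall m, measurable (F m)) ->
  (forall m, (mu (F m) <= (C / (m.+1%:R * m.+2%:R))%:E)%E) ->
  {ae mu, forall w, exists M : nat, forall m, (M <= m)%N -> ~ F m w}.
Proof.
move=> mF muF.
have C0 : 0 <= C.
  have := le_trans (measure_ge0 mu (F 0%N)) (muF 0%N).
  by rewrite lee_fin ler_pdivlMr// mul0r.
have lt_oo : (\sum_(m <oo) mu (F m) < +oo)%E.
  apply: (@le_lt_trans _ _ C%:E); last exact: ltry.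
  apply: lime_le; first by apply: is_cvg_nneseries => *; exact: measure_ge0.
  (* C/((m+1)(m+2)) = C/(m+1) - C/(m+2), so the partial sums stay below [C]. *)
  apply: nearW => n; apply: (@le_trans _ _ (\sum_(0 <= m < n) C * (m.+1%:R^-1 - m.+2%:R^-1))%:E).
    rewrite -sumEFin; apply: lee_sum => m _; apply: le_trans (muF m) _.
    rewrite lee_fin le_eqVlt; apply/orP; left; apply/eqP.
    have -> : m.+2%:R = m.+1%:R + 1 :> R by rewrite natr1.
    have : 0 < m.+1%:R :> R by rewrite ltr0n.
    by move: m.+1%:R => z z0; field; apply/andP; split; lra.
  rewrite -mulr_sumr lee_fin.
  have -> : \sum_(0 <= m < n) (m.+1%:R^-1 - m.+2%:R^-1) = 1 - n.+1%:R^-1 :> R.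
    elim: n => [|n IH]; first by rewrite big_nil invr1 subrr.
    by rewrite big_nat_recr//= IH addrA subrK.
  by rewrite ler_piMr// gerBl invr_ge0.
exists (lim_sup_set F); split.
- by apply: bigcapT_measurable => n; exact: bigcup_measurable.
- exact: lim_sup_set_cvg0.
- move=> w wF n _; apply/not_exists2P => nF; apply: wF; exists n => m nm Fm.
  by case: (nF m) => //; apply.
Qed.

Section EventualOscillation.
Context {dO : measure_display} {Omega : measurableType dO} {R : realType}
  {P : probability Omega R} {d : nat} {T H c0 theta c1 iota : R}
  {X : R -> Omega -> 'rV[R]_d}.
Hypothesis d_ge1 : (1 <= d)%N.
Hypothesis H_gt0 : 0 < H.
Hypothesis theta_ge0 : 0 <= theta.
Hypothesis c0_gt0 : 0 < c0.
Hypothesis X_meas : jointly_measurable T X.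
Hypothesis A1i : assumption1_i P T H c0 theta X.
Hypothesis A1ii : assumption1_ii P T H c1 iota X.

(** Two values more than [rho] apart cannot both be within [rho / 2] of [f t]; the time [t] is
    arbitrary and may lie outside the window. *)
Lemma oscillation_of_increment (f : R -> 'rV[R]_d) (n : nat) (a D rho t : R) (j : 'I_n)
    (l : 'I_d) : 0 <= D ->
  rho < `|f (a + j.+1%:R * D) ord0 l - f (a + j%:R * D) ord0 l| ->
  exists2 s, a <= s <= a + n%:R * D & rho / 2 < `|f t ord0 l - f s ord0 l|.
Proof.
move=> D0 rho_lt.
have in_grid i : (i <= n)%N -> a <= a + i%:R * D <= a + n%:R * D.
  by move=> ilen; rewrite lerDl mulr_ge0//= lerD2l ler_wpM2r// ler_nat.
have [lt1|ge1] := ltP (rho / 2) `|f t ord0 l - f (a + j%:R * D) ord0 l|.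
  by exists (a + j%:R * D) => //; apply: in_grid; exact: ltnW.
exists (a + j.+1%:R * D); first exact: in_grid.
have := ler_distD (f t ord0 l) (f (a + j.+1%:R * D) ord0 l) (f (a + j%:R * D) ord0 l).
rewrite (distrC _ (f t ord0 l)); lra.
Qed.

(** Scale [m] has [K m] windows of length [delta m], each cut into [n m] steps, and the last
    hypothesis makes the union bound summable. The exceptional event is fixed before [t], so all [t]
    are covered at once. One window per scale serves a fixed time, about e^m windows serve all
    times. *)
Lemma eventual_oscillation : exists2 kappa : R, 0 < kappa &
  forall (K n : nat -> nat) (a : nat -> nat -> R) (delta : nat -> R) (C : R),
  (forall m, (0 < n m)%N) -> (forall m k, 0 < a m k) -> (forall m, 0 < delta m) ->
  (forall m, (K m)%:R * expR (- 3 * (n m)%:R) <= C / (m.+1%:R * m.+2%:R)) ->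
  {ae P, forall w, exists M : nat, forall m, (M <= m)%N ->
    forall k, (k < K m)%N -> a m k + delta m < T -> forall t : R,
    exists2 s, a m k <= s <= a m k + delta m & exists l,
      kappa * (delta m / (n m)%:R) `^ H * (n m)%:R `^ (- (H * theta / d%:R))
        < `|X t w ord0 l - X s w ord0 l|}.
Proof.
have [kappa k0 [C0 C00 small]] := small_increments_expR (P := P) (c0 := c0)
  (c1 := c1) (iota := iota) d_ge1 H_gt0 theta_ge0 c0_gt0 X_meas A1i A1ii.
exists (kappa / 2); first exact: divr_gt0.
move=> K n a delta C n0 a0 delta0 KC.
have n0R m : 0 < (n m)%:R :> R by rewrite ltr0n.
pose rho m := kappa * (delta m / (n m)%:R) `^ H * (n m)%:R `^ (- (H * theta / d%:R)).
have nD m : (n m)%:R * (delta m / (n m)%:R) = delta m.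
  by rewrite mulrC mulfVK// gt_eqF.
have D0 m : 0 < delta m / (n m)%:R by exact: divr_gt0.
(* Windows not ending before [T] get the empty event, so that measurability and the bound hold for
   every index. *)
pose G m k : set Omega := if a m k + delta m < T
  then small_increments (X := X) (n m) (a m k) (delta m / (n m)%:R) (rho m) else set0.
have mG m k : measurable (G m k).
  rewrite /G; case: ifP => // aT; apply: (measurable_small_increments X_meas).
  - exact: ltW.
  - exact: ltW.
  - by rewrite nD ltW.
have PG m k : (P (G m k) <= (C0 * expR (- 3 * (n m)%:R))%:E)%E.
  rewrite /G; case: ifP => aT; first by apply: small => //; rewrite nD.
  by rewrite measure0 lee_fin mulr_ge0 ?expR_ge0 ?ltW.
pose F m := \big[setU/set0]_(k < K m) G m k.
have mF m : measurable (F m) by exact: bigsetU_measurable.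
have PF m : (P (F m) <= (C0 * C / (m.+1%:R * m.+2%:R))%:E)%E.
  apply: le_trans (Boole_inequality _ _) _ => //.
  apply: (@le_trans _ _ (\sum_(k < K m) (C0 * expR (- 3 * (n m)%:R))%:E)%E).
    by apply: lee_sum => k _; exact: PG.
  rewrite sumEFin lee_fin sumr_const card_ord -[X in X <= _]mulr_natl mulrCA -mulrA.
  by rewrite ler_pM2l.
apply: filterS (Borel_Cantelli_telescoping _ _ _ mF PF) => w [M nF].
exists M => m Mm k kK aT t.
have [j [l lt_rho]] : exists (j : 'I_(n m)) l, rho m <
    `|X (a m k + j.+1%:R * (delta m / (n m)%:R)) w ord0 l -
      X (a m k + j%:R * (delta m / (n m)%:R)) w ord0 l|.
  apply: contrapT => no; apply: (nF m Mm); rewrite /F.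
  rewrite -(bigcup_mkord _ (G m)); exists k => //; rewrite /G aT => j l.
  by rewrite leNgt; apply/negP => lt_rho; apply: no; exists j, l.
have [s sI lt_s] := oscillation_of_increment (fun s => X s w) _ _ _ _ t _ _ (ltW (D0 m)) lt_rho.
exists s; first by rewrite nD in sI.
by exists l; apply: le_lt_trans lt_s; rewrite le_eqVlt /rho; apply/orP; left; apply/eqP; ring.
Qed.

End EventualOscillation.

(** * From discrete scales to all small radii *)

Lemma modulus_le {R : realType} (H g E c : R) :
  0 < H -> 0 <= g -> H + g <= E -> 0 < c ->
  exists2 C : R, 0 < C & forall (r x delta : R) (n : nat),
    0 < r -> 1 <= x -> (0 < n)%N -> n%:R <= 3 * x -> c * r <= delta ->
    C * (r `^ H * x `^ (- E)) <= (delta / n%:R) `^ H * n%:R `^ (- g).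
Proof.
move=> H0 g0 HgE c0_gt0; exists (c `^ H / 3 `^ (H + g)).
  by rewrite divr_gt0 ?powR_gt0.
move=> r x delta n r0 x1 n0 n3x cr.
have n0R : 0 < n%:R :> R by rewrite ltr0n.
have delta0 : 0 < delta by apply: lt_le_trans cr; exact: mulr_gt0.
have Hg0 : 0 <= H + g by rewrite addr_ge0// ltW.
(* Here [n] collects the total exponent -(H + g), which n <= 3x and x >= 1 compare with x^(-E). *)
have -> : (delta / n%:R) `^ H * n%:R `^ (- g) = delta `^ H / n%:R `^ (H + g).
  rewrite powRM ?invr_ge0 ?(ltW delta0) ?(ltW n0R)// -powR_inv1 ?(ltW n0R)// -powRrM mulN1r -mulrA.
  by rewrite -powRD ?(gt_eqF n0R) ?implybT// -opprD powRN.
rewrite powRN mulrACA -invfM -powRM ?(ltW r0) ?(ltW c0_gt0)//.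
apply: ler_pM; rewrite ?powR_ge0 ?invr_ge0 ?mulr_ge0 ?powR_ge0//.
  apply: ge0_ler_powR => //; first exact: ltW.
    by rewrite nnegrE mulr_ge0// ltW.
  by rewrite nnegrE ltW.
rewrite lef_pV2 ?posrE ?mulr_gt0 ?powR_gt0//; last lra.
apply: (@le_trans _ _ ((3 * x) `^ (H + g))).
  by apply: ge0_ler_powR => //; rewrite nnegrE; [exact: ltW|lra].
rewrite powRM//; last lra.
by rewrite ler_wpM2l ?powR_ge0// ler_powR.
Qed.

Section LogScale.
Context {R : realType}.

(** The scale e^(-(m+1)) is below [r] and within a factor e of it, so a window of that length fits
    in the radius at the cost of a constant. *)
Lemma log_scale (r : R) (m := Num.truncn (ln r^-1)) : 0 < r -> 0 <= ln r^-1 ->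
  [/\ m%:R <= ln r^-1, expR (- m.+1%:R) < r & (expR 1)^-1 * r <= expR (- m.+1%:R)].
Proof.
move=> r0 L0; have rE : expR (- ln r^-1) = r by rewrite lnV ?posrE// opprK lnK.
have mL : m%:R <= ln r^-1 by rewrite truncn_le.
split => //; first by rewrite -[X in _ < X]rE ltr_expR ltrN2 truncnS_gt.
rewrite -expRN -[X in _ * X]rE -expRD ler_expR -natr1; lra.
Qed.

Lemma truncn_le_of_lt (M : nat) (x : R) : M%:R < x -> (M <= Num.truncn x)%N.
Proof. by move=> Mx; rewrite truncn_ge_nat ?ltW// (le_lt_trans _ Mx). Qed.

Lemma lt_of_ln_lt (r y : R) : 0 < r -> 0 < y -> ln y^-1 < ln r^-1 -> r < y.
Proof.
by move=> r0 y0; rewrite ltr_ln ?posrE ?invr_gt0// ltf_pV2.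
Qed.

Lemma expR1_ge2 : 2 <= expR 1 :> R.
Proof. have := expR_ge1Dx (1 : R); lra. Qed.

End LogScale.

(** * Oscillation at a fixed time, and at all times simultaneously *)

Section Oscillation.
Context {dO : measure_display} {Omega : measurableType dO} {R : realType}
  {P : probability Omega R} {d : nat} {T H c0 theta c1 iota : R}
  {X : R -> Omega -> 'rV[R]_d}.
Hypothesis d_ge1 : (1 <= d)%N.
Hypothesis T_gt0 : 0 < T.
Hypothesis H_gt0 : 0 < H.
Hypothesis theta_ge0 : 0 <= theta.
Hypothesis c0_gt0 : 0 < c0.
Hypothesis X_meas : jointly_measurable T X.
Hypothesis A1i : assumption1_i P T H c0 theta X.
Hypothesis A1ii : assumption1_ii P T H c1 iota X.
Variable E : R.
Hypothesis E_ge : H + H * theta / d%:R <= E.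

(** Stated by coordinates to bound from below both the Euclidean norm in [sup_ratio] and the sup
    norm of difference quotients. *)
Definition oscillates (f : R -> 'rV[R]_d) (t r c : R) : Prop :=
  exists s, [/\ t - r < s < t + r, 0 <= s <= T &
    exists l, c < `|f t ord0 l - f s ord0 l|].

Let g_ge0 : 0 <= H * theta / d%:R.
Proof. by rewrite divr_ge0// mulr_ge0// ltW. Qed.

(** One window per scale, starting at [t]: then [n m] of order log m is enough for summability,
    hence the iterated logarithm. *)
Lemma local_oscillation (t : R) : 0 < t < T -> exists2 c : R, 0 < c &
  {ae P, forall w, exists y : R, forall r, 0 < r -> y < ln r^-1 ->
    1 <= ln (ln r^-1) /\
    oscillates (X ^~ w) t r (c * (r `^ H * ln (ln r^-1) `^ (- E)))}.
Proof.
move=> /andP[t0 tT].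
have [kappa k0 osc] := eventual_oscillation (P := P) (c0 := c0)
  (c1 := c1) (iota := iota) d_ge1 H_gt0 theta_ge0 c0_gt0 X_meas A1i A1ii.
have e_gt0 : 0 < (expR 1)^-1 :> R by rewrite invr_gt0 expR_gt0.
have [C C0 modulus] := modulus_le _ _ _ _ H_gt0 g_ge0 E_ge e_gt0.
exists (kappa * C); first exact: mulr_gt0.
(* [n m] exceeds ln(m+2), so e^(-3n) is at most (m+2)^(-3). *)
pose n m := (Num.truncn (ln m.+2%:R : R)).+1.
have KC m : 1%:R * expR (- 3 * (n m)%:R) <= 1 / (m.+1%:R * m.+2%:R) :> R.
  rewrite !mul1r mulNr expRN expRM_natl.
  have z0 : 1 <= m.+1%:R :> R by rewrite ler1n.
  have q_ge : m.+2%:R <= expR (n m)%:R :> R.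
    by rewrite -[leLHS]lnK ?posrE ?ltr0n// ler_expR ltW// truncnS_gt.
  move: q_ge; rewrite -(natr1 m.+1); move: m.+1%:R z0 => z z1 q_ge.
  rewrite lef_pV2 ?posrE ?exprn_gt0 ?expR_gt0//; last nra.
  move: (expR _) q_ge => q zq; rewrite !exprS expr0 mulr1.
  apply: (@le_trans _ _ (q * q)); [nra|rewrite ler_peMl; nra].
have := osc (fun=> 1%N) n (fun _ _ => t) (fun m => expR (- m.+1%:R)) 1
  (fun m => ltn0Sn _) (fun _ _ => t0) (fun m => expR_gt0 _) KC.
apply: filterS => w [M osc_w].
(* The thresholds put the scale past [M], make the iterated logarithm at least 1, and make the
   window end before [T]. *)
exists (Num.max (Num.max M%:R (expR 1)) (ln (T - t)^-1)) => r r0.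
rewrite !gt_max => /andP[/andP[ML eL] rT].
have L0 : 0 < ln r^-1 by apply: lt_trans eL; exact: expR_gt0.
have [mL lt_r ge_r] := log_scale r r0 (ltW L0).
have r_lt : r < T - t by apply: lt_of_ln_lt => //; rewrite subr_gt0.
have Mm := truncn_le_of_lt M _ ML.
set m := Num.truncn (ln r^-1) in mL lt_r ge_r Mm.
have tm : t + expR (- m.+1%:R) < T by lra.
have x1 : 1 <= ln (ln r^-1) by rewrite -[leLHS]expRK ler_ln ?posrE ?expR_gt0// ltW.
split => //.
have [s /andP[ts st] [l lt_l]] := osc_w m Mm 0%N isT tm t.
exists s; split; [apply/andP; split; lra|apply/andP; split; lra|].
exists l; apply: le_lt_trans lt_l; rewrite -!mulrA ler_pM2l// !mulrA -mulrA.
apply: modulus => //.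
rewrite /n -[leLHS]natr1.
have n_le : (Num.truncn (ln m.+2%:R : R))%:R <= ln m.+2%:R :> R.
  by rewrite truncn_le ln_ge0// ler1n.
(* m + 2 <= e ln(1/r), since m <= ln(1/r) and ln(1/r) > e >= 2; hence n <= ln ln(1/r) + 2 <= 3 ln
   ln(1/r). *)
have ln_le : ln m.+2%:R <= ln (ln r^-1) + 1 :> R.
  rewrite -[X in _ + X]expRK -lnM ?posrE ?expR_gt0// ler_ln ?posrE ?mulr_gt0 ?expR_gt0//.
  rewrite -2!natr1; have := @expR1_ge2 R; nra.
lra.
Qed.

(** Consecutive windows, of a quarter of the scale, provide one within distance [r] of each [t]; the
    union over about e^m of them takes [n m] of order m, hence a single logarithm. *)
Lemma uniform_oscillation : exists2 c : R, 0 < c &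
  {ae P, forall w, exists y : R, forall r, 0 < r -> y < ln r^-1 ->
    1 <= ln r^-1 /\ forall t, 0 <= t <= T ->
    oscillates (X ^~ w) t r (c * (r `^ H * ln r^-1 `^ (- E)))}.
Proof.
have [kappa k0 osc] := eventual_oscillation (P := P) (c0 := c0)
  (c1 := c1) (iota := iota) d_ge1 H_gt0 theta_ge0 c0_gt0 X_meas A1i A1ii.
have e_gt0 : 0 < (expR 1)^-1 / 4 :> R by rewrite divr_gt0// invr_gt0 expR_gt0.
have [C C0 modulus] := modulus_le _ _ _ _ H_gt0 g_ge0 E_ge e_gt0.
exists (kappa * C); first exact: mulr_gt0.
pose delta m : R := expR (- m.+1%:R) / 4.
have delta0 m : 0 < delta m by rewrite divr_gt0// expR_gt0.
pose K m := (Num.truncn (T / delta m)).+1.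
have KC m : (K m)%:R * expR (- 3 * m.+1%:R) <= 2 * (4 * T + 1) / (m.+1%:R * m.+2%:R).
  set q := expR m.+1%:R : R.
  have z0 : 1 <= m.+1%:R :> R by rewrite ler1n.
  have q_ge : 1 + m.+1%:R <= q by exact: expR_ge1Dx.
  have q0 : 0 < q by exact: expR_gt0.
  have -> : expR (- 3 * m.+1%:R) = (q ^+ 3)^-1 by rewrite mulNr expRN expRM_natl.
  have K_le : (K m)%:R <= (4 * T + 1) * q.
    have T_le : (Num.truncn (T / delta m))%:R <= T / delta m.
      by rewrite truncn_le divr_ge0// ltW.
    have Td : T / delta m = 4 * T * q.
      by rewrite /delta expRN -/q; field; rewrite gt_eqF.
    rewrite /K -[leLHS]natr1; rewrite Td in T_le *; nra.
  (* Order q windows against failure probability of order q^(-3) leave q^(-2), with q = e^(m+1). *)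
  apply: (@le_trans _ _ ((4 * T + 1) * q * (q ^+ 3)^-1)).
    by rewrite ler_wpM2r// invr_ge0 exprn_ge0// ltW.
  have -> : (4 * T + 1) * q * (q ^+ 3)^-1 = (4 * T + 1) * (q ^+ 2)^-1.
    by field; rewrite gt_eqF.
  rewrite (mulrC 2) -mulrA ler_pM2l; last by rewrite addr_gt0// mulr_gt0.
  rewrite -(natr1 m.+1); move: m.+1%:R z0 q_ge => z z1 q_ge.
  rewrite ler_pdivlMr; last nra.
  rewrite mulrC ler_pdivrMr ?exprn_gt0// expr2; nra.
(* Windows start at [k.+1] steps, since the interval from 0 to the window must have positive
   length. *)
have := osc K S (fun m k => k.+1%:R * delta m) delta (2 * (4 * T + 1))
  (fun m => ltn0Sn _) (fun m k => mulr_gt0 (ltr0Sn _ _) (delta0 m)) delta0 KC.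
apply: filterS => w [M osc_w].
exists (Num.max (Num.max M%:R 1) (ln T^-1)) => r r0.
rewrite !gt_max => /andP[/andP[ML L1] rT].
have L0 : 0 < ln r^-1 by lra.
have [mL lt_r ge_r] := log_scale r r0 (ltW L0).
have r_lt : r < T by exact: lt_of_ln_lt.
have Mm := truncn_le_of_lt M _ ML.
set m := Num.truncn (ln r^-1) in mL lt_r ge_r Mm.
split=> [|t /andP[t0 tT]]; first exact: ltW.
have dm0 := delta0 m.
have dm4 : expR (- m.+1%:R) = 4 * delta m by rewrite /delta; field.
rewrite dm4 in lt_r ge_r.
(* For [t] below 3 delta the first window works; otherwise the one from (q-2) delta to (q-1) delta,
   which ends before [t] and so before [T]. Both fit because r > 4 delta. *)
have [k [kK kT tk kt]] : exists k, [/\ (k < K m)%N, k.+1%:R * delta m + delta m < T,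
    t - r < k.+1%:R * delta m & k.+1%:R * delta m + delta m < t + r].
  have [t3|t3] := ltP t (3 * delta m).
    by exists 0%N; rewrite mul1r; split => //; lra.
  pose q := Num.truncn (t / delta m).
  have td0 : 0 <= t / delta m by rewrite divr_ge0// ltW.
  have q3 : (3 <= q)%N by rewrite (truncn_ge_nat _ td0) ler_pdivlMr.
  have q_le : q%:R * delta m <= t.
    by rewrite -ler_pdivlMr// truncn_le.
  have q_gt : t < (q%:R + 1) * delta m.
    by rewrite -ltr_pdivrMr// natr1 truncnS_gt.
  have q_leT : (q <= Num.truncn (T / delta m))%N.
    by apply: le_truncn; rewrite ler_pM2r ?invr_gt0.
  have qE : (q - 3).+1%:R = q%:R - 2 :> R.
    by rewrite -subSn// -[in RHS](@natrB _ q 2) ?subSS// ltnW.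
  exists (q - 3)%N; rewrite qE; split; [|lra|lra|lra].
  by rewrite ltnS (leq_trans (leq_subr _ _)).
have [s /andP[ts st] [l lt_l]] := osc_w m Mm k kK kT t.
have a0 : 0 < k.+1%:R * delta m by exact: mulr_gt0.
exists s; split; [apply/andP; split; lra|apply/andP; split; lra|].
exists l; apply: le_lt_trans lt_l; rewrite -!mulrA ler_pM2l// !mulrA -mulrA.
apply: modulus => //; [lra|rewrite -[leLHS]natr1; lra|lra].
Qed.

End Oscillation.

(** * Lower limits, nowhere differentiability and the conclusion *)

Lemma limf_einf_right_ge {R : realType} (f : R -> \bar R) (c : \bar R) (y : R) :
  (forall r, 0 < r -> y < ln r^-1 -> (c <= f r)%E) ->
  (c <= limf_einf f 0^'+)%E.
Proof.
move=> cf; rewrite limf_einfE.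
apply: le_trans (ereal_sup_ubound _); last first.
  exists [set r | 0 < r < expR (- y)]; last by [].
  near=> r; apply/andP; split; near: r; first exact: nbhs_right_gt.
  by apply: nbhs_right_lt; exact: expR_gt0.
apply: le_ereal_inf_tmp => _ [r /andP[r0 ry] <-]; apply: cf => //.
by rewrite lnV ?posrE// ltrNr -ltr_expR lnK ?posrE.
Unshelve. all: by end_near. Qed.

Lemma coord_le_mx_norm {R : realType} (d : nat) (u : 'rV[R]_d) (l : 'I_d) :
  `|u ord0 l| <= `|u|.
Proof.
rewrite [leRHS]/Num.norm /= mx_normrE.
exact: (@le_bigmax _ _ _ _ (fun ij : 'I_1 * 'I_d => `|u ij.1 ij.2|) (ord0, l)).
Qed.

(** For r = e^(-L) the ratio of r to r^H is e^(-2bL): one factor e^(-bL) beats the power L^E, the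
    other beats the constants. *)
Lemma linear_le_modulus {R : realType} (H E c y C : R) :
  H < 1 -> 0 < E -> 0 < c -> 0 < C ->
  exists r, [/\ 0 < r, y < ln r^-1 & C * r <= c * (r `^ H * ln r^-1 `^ (- E))].
Proof.
move=> H1 E0 c0 C0.
pose b := (1 - H) / 2; have b0 : 0 < b by rewrite divr_gt0// subr_gt0.
have bE : 0 < b / E by exact: divr_gt0.
pose K := (E / b) `^ E; have K0 : 0 < K by rewrite powR_gt0// divr_gt0.
(* The last entry gives C K <= c b L <= c e^(bL). *)
pose L := Num.max 1 (Num.max (y + 1) (C * K / (c * b))).
have [L1 Ly LC] : [/\ 1 <= L, y + 1 <= L & C * K / (c * b) <= L].
  by rewrite !le_max !lexx !orbT.
have L0 : 0 < L by lra.
exists (expR (- L)); rewrite -expRN opprK expRK expR_gt0; split => //; first lra.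
(* This is 1 + x <= e^x at x = bL/E, raised to the power [E]. *)
have LE_le : L `^ E <= expR (b * L) * K.
  have Eb0 : 0 < E / b by exact: divr_gt0.
  have -> : expR (b * L) * K = (expR (b / E * L) * (E / b)) `^ E.
    rewrite powRM ?expR_ge0 ?(ltW Eb0)// -expRM; congr (expR _ * _).
    by field; rewrite gt_eqF.
  apply: ge0_ler_powR; rewrite ?nnegrE ?(ltW E0) ?(ltW L0)//.
    by rewrite mulr_ge0 ?expR_ge0// ltW.
  have := expR_ge1Dx (b / E * L).
  by rewrite -ler_pdivrMr// invf_div [L * _]mulrC; lra.
have LE0 : 0 < L `^ E by exact: powR_gt0.
rewrite powRN -expRM mulrA ler_pdivlMr//.
set q := expR (b * L) in LE_le.
have q0 : 0 < q by exact: expR_gt0.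
have eL : expR (- L) = expR (- L * H) / (q * q).
  by rewrite -expRD -expRN -expRD; congr expR; rewrite /b; field.
rewrite eL; set u := expR (- L * H); have u0 : 0 < u by exact: expR_gt0.
have CK : C * K <= c * q.
  have := expR_ge1Dx (b * L); rewrite -/q; move: LC.
  rewrite ler_pdivrMr ?(mulr_gt0 c0 b0)// => LC1 LC2; nra.
apply: (@le_trans _ _ (C * (u / (q * q)) * (q * K))).
  by rewrite ler_wpM2l// ltW// mulr_gt0// divr_gt0// mulr_gt0.
have -> : C * (u / (q * q)) * (q * K) = u * (C * K / q) by field; rewrite gt_eqF.
by rewrite [leRHS]mulrC ler_pM2l// ler_pdivrMr.
Qed.

Section Paths.
Context {R : realType} {d : nat} {T : R}.

Lemma oscillates_sup_ratio (f : R -> 'rV[R]_d) (t r c g : R) :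
  0 < g -> oscillates (T := T) f t r (c * g) -> (c%:E <= sup_ratio T f g t r)%E.
Proof.
move=> g0 [s [str sT [l lt_l]]].
apply: (@le_trans _ _ (enorm (f t - f s) / g)%:E).
  rewrite lee_fin ler_pdivlMr// (le_trans (ltW lt_l))//.
  by have := coord_le_enorm (f t - f s) l; rewrite !mxE.
by apply: ereal_sup_ubound; exists s => //; split; rewrite /= in_itv.
Qed.

(** Near a point of differentiability increments are at most (|v| + 1)|s - t|, whereas
    [linear_le_modulus] supplies a radius at which the oscillation exceeds this. *)
Lemma nowhere_differentiable_of_oscillates (f : R -> 'rV[R]_d) (H E c y : R) :
  H < 1 -> 0 < E -> 0 < c ->
  (forall r, 0 < r -> y < ln r^-1 -> forall t, 0 <= t <= T ->
     oscillates (T := T) f t r (c * (r `^ H * ln r^-1 `^ (- E)))) ->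
  nowhere_differentiable T f.
Proof.
move=> H1 E0 c0 osc t tT [v cvg_v].
have : \forall s \near within `[0, T]%classic t^',
    `|(s - t)^-1 *: (f s - f t)| <= `|v| + 1.
  by apply: (cvgr_norm_le _ cvg_v); rewrite ltrDl.
rewrite /within /dnbhs /= => /nbhs_ballP[e /= e0 ball_le].
have C0 : 0 < `|v| + 1 by rewrite ltr_wpDl.
have [r [r0 yr le_r]] := linear_le_modulus H E c (Num.max y (ln e^-1)) _ H1 E0 c0 C0.
move: yr; rewrite gt_max => /andP[yr er].
have r_lt : r < e by exact: lt_of_ln_lt.
have [|s [/andP[ts st] sT [l lt_l]]] := osc r r0 yr t; first by rewrite in_itv in tT.
have st_r : `|s - t| < r by rewrite ltr_norml; apply/andP; split; lra.
(* The quotient is controlled only for [s] distinct from [t]; a zero increment cannot exceed a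
   nonnegative level. *)
have [st0|st0] := eqVneq s t.
  move: lt_l; rewrite st0 subrr normr0 ltNge => /negP; apply.
  by rewrite !mulr_ge0 ?powR_ge0 ?ltW.
have le_C : `|(s - t)^-1 *: (f s - f t)| <= `|v| + 1.
  by apply: ball_le => //=; rewrite -ball_normE /= distrC (lt_trans st_r).
have st_gt0 : 0 < `|s - t| by rewrite normr_gt0 subr_eq0.
have : `|f t ord0 l - f s ord0 l| <= (`|v| + 1) * `|s - t|.
  rewrite distrC -ler_pdivrMr// mulrC -normfV -normrM.
  by apply: le_trans le_C; have := coord_le_mx_norm _ ((s - t)^-1 *: (f s - f t)) l; rewrite !mxE.
have : (`|v| + 1) * `|s - t| <= (`|v| + 1) * r by rewrite ler_pM2l// ltW.
lra.
Qed.

End Paths.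

Theorem theorem2p3 (dO : measure_display) (Omega : measurableType dO)
    (R : realType) (P : probability Omega R) (d : nat)
    (T H c0 theta c1 iota alpha : R) (X : R -> Omega -> 'rV[R]_d)
    (d_ge1 : (1 <= d)%N) (T_gt0 : 0 < T) (H_gt0 : 0 < H) (H_lt1 : H < 1)
    (X_meas : jointly_measurable T X)
    (c0_gt0 : 0 < c0) (theta_ge0 : 0 <= theta)
    (A1i : assumption1_i P T H c0 theta X)
    (c1_ge0 : 0 <= c1) (iota_ge0 : 0 <= iota)
    (A1ii : assumption1_ii P T H c1 iota X)
    (alpha_small : H * d%:R < 1 -> 0 <= alpha < d%:R)
    (alpha_large : 1 <= H * d%:R -> Num.max 0 (d%:R - 1 / H) < alpha < d%:R) :
  [/\ (forall t : R, 0 < t < T ->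
         exists2 c4 : R, 0 < c4 &
           {ae P, forall w,
             (c4%:E <= limf_einf (fun r : R =>
                sup_ratio T (X ^~ w)
                  (r `^ H * ln (ln r^-1)
                     `^ (- H * (theta / (d%:R - alpha) + 1))) t r)
                0^'+)%E}),
      (exists2 c5 : R, 0 < c5 &
         {ae P, forall w,
           (c5%:E <= limf_einf (fun r : R =>
              ereal_inf [set sup_ratio T (X ^~ w)
                (r `^ H * ln r^-1
                   `^ (- H * (theta / (d%:R - alpha) + 1))) t r |
                t in `]0%R, T[%classic])
              0^'+)%E}) &
      {ae P, forall w, nowhere_differentiable T (X ^~ w)}].
Proof.
have [alpha_ge0 alpha_lt] : 0 <= alpha /\ alpha < d%:R.
  have [Hd1|Hd1] := ltP (H * d%:R) 1; first exact/andP/alpha_small.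
  by have := alpha_large Hd1; rewrite gt_max => /andP[/andP[/ltW]].
have d_gt0 : 0 < d%:R :> R by rewrite ltr0n.
(* As alpha >= 0, d - alpha <= d, so the stated exponent dominates the one obtained with [d]. *)
have E_ge : H + H * theta / d%:R <= H * (theta / (d%:R - alpha) + 1).
  rewrite mulrDr mulr1 addrC lerD2r -mulrA ler_pM2l// ler_wpM2l//.
  by rewrite lef_pV2 ?posrE ?subr_gt0// gerBl.
have E_gt0 : 0 < H * (theta / (d%:R - alpha) + 1).
  by apply: lt_le_trans E_ge; rewrite ltr_wpDr// divr_ge0// mulr_ge0// ltW.
rewrite mulNr; set E := H * (_ + 1) in E_ge E_gt0 *.
have [c c_gt0 unif] := uniform_oscillation (P := P) d_ge1 T_gt0 H_gt0 theta_ge0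
  c0_gt0 X_meas A1i A1ii E E_ge.
split.
- move=> t tT.
  have [c4 c4_gt0 loc] := local_oscillation (P := P) d_ge1 H_gt0 theta_ge0
    c0_gt0 X_meas A1i A1ii E E_ge t tT.
  exists c4 => //; apply: filterS loc => w [y osc].
  apply: (limf_einf_right_ge _ _ y) => r r0 yr; have [x1 osc_r] := osc r r0 yr.
  apply: oscillates_sup_ratio osc_r.
  by rewrite mulr_gt0// powR_gt0// (lt_le_trans _ x1).
- exists c => //; apply: filterS unif => w [y osc].
  apply: (limf_einf_right_ge _ _ y) => r r0 yr; have [x1 osc_r] := osc r r0 yr.
  apply: le_ereal_inf_tmp => _ [t /= t_in <-]; move: t_in; rewrite in_itv /= => /andP[t0 tT].
  apply: oscillates_sup_ratio; last by apply: osc_r; rewrite !ltW.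
  by rewrite mulr_gt0// powR_gt0// (lt_le_trans _ x1).
(* The uniform bound includes both endpoints of the time interval, so the same event serves. *)
- apply: filterS unif => w [y osc].
  apply: (nowhere_differentiable_of_oscillates _ H E c y) => // r r0 yr t tT.
  by have [_] := osc r r0 yr; apply.
Qed.
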